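(* Let $A$ and $B$ be $C^*$-algebras, let $n \geq 2$ be an even integer, and let $\phi : A \to B$ be an involutive $n$-homomorphism. Then $\phi$ is completely positive. Consequently, $\phi$ is bounded.
   Context: An $n$-homomorphism between algebras $A$ and $B$ is a linear map $\phi : A \to B$ with $\phi(a_1 a_2 \cdots a_n) = \phi(a_1)\phi(a_2)\cdots\phi(a_n)$ for all $a_1,\dots,a_n \in A$. It is involutive if $\phi(a^* ) = \phi(a)^*$ for all $a \in A$. A linear map $\theta : A \to B$ between $C^*$-algebras is positive if $a \geq 0$ implies $\theta(a) \geq 0$, and completely positive if for all $k \geq 1$ the induced map $\theta_k : M_k(A) \to M_k(B)$, $\theta_k((a_{ij})) = (\theta(a_{ij}))$, on $k \times k$ matrices is positive. The $C^*$-algebras are not assumed unital and $\phi$ is not assumed continuous. *)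

(* Defs.v *)
From HB Require Import structures.
From mathcomp Require Import all_boot all_order all_algebra.
From mathcomp Require Import complex.
From mathcomp Require Import all_classical all_reals all_analysis.

Set Implicit Arguments.
Unset Strict Implicit.
Unset Printing Implicit Defensive.

Import Order.TTheory GRing.Theory Num.Theory numFieldNormedType.Exports.

Local Open Scope ring_scope.

(* MathComp rings are unital, whereas C*-algebras are not assumed unital here,
   so the multiplication of a *-ring is a separate operation [cmul]. *)
HB.mixin Record Zmodule_isStarRng A of GRing.Zmodule A := {
  cmul : A -> A -> A;
  star : A -> A;
  cmulA : associative cmul;
  cmulDl : left_distributive cmul +%R;
  cmulDr : right_distributive cmul +%R;
  starK : involutive star;
  starD : {morph star : a b / a + b};
  starM : forall a b : A, star (cmul a b) = cmul (star b) (star a)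
}.

#[short(type="starRngType")]
HB.structure Definition StarRng :=
  {A of GRing.Zmodule A & Zmodule_isStarRng A}.

Notation "a ** b" := (cmul a b) (at level 40, left associativity) : ring_scope.

(* The norm of a normed module over [R[i]] takes its values in [R[i]]: it is
   real and nonnegative for the order of [R[i]], in which [x <= y] means that
   [y - x] is a nonnegative real. *)
HB.mixin Record isCstarAlgebra (R : realType) A
    of StarRng A & CompleteNormedModule R[i] A := {
  cscalerAl : forall (k : R[i]) (a b : A), k *: (a ** b) = (k *: a) ** b;
  cscalerAr : forall (k : R[i]) (a b : A), k *: (a ** b) = a ** (k *: b);
  starZ : forall (k : R[i]) (a : A), star (k *: a) = k^* *: star a;
  cnormM : forall a b : A, `|a ** b| <= `|a| * `|b|;
  cnorm_star : forall a : A, `|star a ** a| = `|a| ^+ 2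
}.

#[short(type="cstarAlgType")]
HB.structure Definition CstarAlgebra (R : realType) :=
  {A of StarRng A & CompleteNormedModule R[i] A & isCstarAlgebra R A}.

Definition mxcmul (A : starRngType) k (M N : 'M[A]_k) : 'M[A]_k :=
  \matrix_(i, j) \sum_(l < k) M i l ** N l j.

Definition mxstar (A : starRngType) k (M : 'M[A]_k) : 'M[A]_k :=
  \matrix_(i, j) star (M j i).

Lemma cmul0r (A : starRngType) (a : A) : 0 ** a = 0.
Proof. by apply: (addIr (0 ** a)); rewrite -cmulDl !add0r. Qed.

Lemma cmulr0 (A : starRngType) (a : A) : a ** 0 = 0.
Proof. by apply: (addIr (a ** 0)); rewrite -cmulDr !add0r. Qed.

Lemma star0 (A : starRngType) : star (0 : A) = 0.
Proof. by apply: (addIr (star 0)); rewrite -starD !add0r. Qed.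

Lemma cmul_suml (A : starRngType) (I : Type) (s : seq I) (F : I -> A) (b : A) :
  (\sum_(i <- s) F i) ** b = \sum_(i <- s) F i ** b.
Proof.
exact: (big_morph (fun a => a ** b) (fun x y => cmulDl x y b) (cmul0r b)).
Qed.

Lemma cmul_sumr (A : starRngType) (I : Type) (s : seq I) (F : I -> A) (a : A) :
  a ** (\sum_(i <- s) F i) = \sum_(i <- s) a ** F i.
Proof. exact: (big_morph (cmul a) (cmulDr a) (cmulr0 a)). Qed.

Lemma star_sum (A : starRngType) (I : Type) (s : seq I) (F : I -> A) :
  star (\sum_(i <- s) F i) = \sum_(i <- s) star (F i).
Proof. exact: (big_morph star (@starD A) (star0 A)). Qed.

Lemma mxcmulA (A : starRngType) k : associative (@mxcmul A k).
Proof.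
move=> M N P; apply/matrixP => i j; rewrite !mxE.
transitivity (\sum_l \sum_m (M i l ** (N l m ** P m j))).
  by apply: eq_bigr => l _; rewrite mxE cmul_sumr.
rewrite exchange_big; apply: eq_bigr => m _; rewrite mxE cmul_suml.
by apply: eq_bigr => l _; rewrite cmulA.
Qed.

Lemma mxcmulDl (A : starRngType) k : left_distributive (@mxcmul A k) +%R.
Proof.
move=> M N P; apply/matrixP => i j; rewrite !mxE -big_split /=.
by apply: eq_bigr => l _; rewrite mxE cmulDl.
Qed.

Lemma mxcmulDr (A : starRngType) k : right_distributive (@mxcmul A k) +%R.
Proof.
move=> M N P; apply/matrixP => i j; rewrite !mxE -big_split /=.
by apply: eq_bigr => l _; rewrite mxE cmulDr.
Qed.

Lemma mxstarK (A : starRngType) k : involutive (@mxstar A k).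
Proof. by move=> M; apply/matrixP => i j; rewrite !mxE starK. Qed.

Lemma mxstarD (A : starRngType) k : {morph @mxstar A k : M N / M + N}.
Proof. by move=> M N; apply/matrixP => i j; rewrite !mxE starD. Qed.

Lemma mxstarM (A : starRngType) k (M N : 'M[A]_k) :
  mxstar (mxcmul M N) = mxcmul (mxstar N) (mxstar M).
Proof.
apply/matrixP => i j; rewrite !mxE star_sum.
by apply: eq_bigr => l _; rewrite !mxE starM.
Qed.

HB.instance Definition _ (A : starRngType) k :=
  Zmodule_isStarRng.Build 'M[A]_k (@mxcmulA A k) (@mxcmulDl A k)
    (@mxcmulDr A k) (@mxstarK A k) (@mxstarD A k) (@mxstarM A k).

(* The positive elements of a C*-algebra are the elements [b^* b].  When [A] is
   a C*-algebra, so is ['M[A]_k] for the *-ring structure above and a unique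
   norm, which positivity does not mention. *)
Definition cpos (A : starRngType) (a : A) : Prop :=
  exists b : A, a = star b ** b.

Definition positive_map (A B : starRngType) (theta : A -> B) : Prop :=
  forall a : A, cpos a -> cpos (theta a).

Definition completely_positive (A B : starRngType) (theta : A -> B) : Prop :=
  forall k : nat, (0 < k)%N ->
    positive_map (map_mx theta : 'M[A]_k -> 'M[B]_k).

Definition involutive_map (A B : starRngType) (phi : A -> B) : Prop :=
  forall a : A, phi (star a) = star (phi a).

(* The product of the nonempty sequence [a :: s]; in the absence of a unit there
   is no empty product. *)
Definition cprod (A : starRngType) (a : A) (s : seq A) : A := foldl cmul a s.

Definition nhom (A B : starRngType) (n : nat) (phi : A -> B) : Prop :=
  forall (a : A) (s : seq A), (size s).+1 = n ->
    phi (cprod a s) = cprod (phi a) (map phi s).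

Definition bounded_map (R : realType) (A B : cstarAlgType R) (phi : A -> B) :
    Prop :=
  exists M : R, forall a : A, `|phi a| <= M%:C%C * `|a|.

(* Main.v *)
(* Everything rests on two spectrum-free constructions.

   Complete positivity. By Cohen's argument, finitely many elements of A have a
   common right factor; iterating, the entries of a matrix over A can be written
   b_ij = c_ij e_2 ... e_m with n = 2m. Then each summand of (b^* b)_ij is a
   product of exactly n elements, so phi maps it to the corresponding product,
   and phi(b^* b) = z^* z with z_ij = phi(c_ij) phi(e_2) ... phi(e_m). The
   approximate unit needed by Cohen's argument comes from averaging the powers of
   a Cayley transform, which act isometrically.

   Boundedness. For x self-adjoint with |x| <= 1/2 and n = 2h + 2, solve
   2 v = x^n + v x^(2h) v in A by iteration. All words here have length n or 1,
   so X = phi(x) and V = phi(v) satisfy the same equation in B. With Q = X^(n-1)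
   and P = X^h V X^h this reads Q^2 + (1 - P)^2 = 1, so Q + i (1 - P) and
   Q - i (1 - P) are unitary in the unitization, hence |X|^(n-1) = |Q| <= 1. *)
Require Import Defs.
From mathcomp Require Import all_boot all_order all_algebra.
From mathcomp Require Import complex.
From mathcomp Require Import all_classical all_reals all_analysis.
From mathcomp Require Import zify lra.

Set Implicit Arguments.
Unset Strict Implicit.
Unset Printing Implicit Defensive.

Import Order.TTheory GRing.Theory Num.Theory numFieldNormedType.Exports.

Local Open Scope ring_scope.

(** * Equalities in abelian groups *)

(** Reflection: two abelian-group expressions agree once each atom has the same integer coefficient
    in both. Products count as atoms, so they are expanded before [zmod] is called. *)
Inductive zmod_expr :=
  | ZmodVar of nat | ZmodZero
  | ZmodAdd of zmod_expr & zmod_expr | ZmodOpp of zmod_expr.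

Fixpoint zmod_eval (V : zmodType) (env : seq V) (e : zmod_expr) : V :=
  match e with
  | ZmodVar n => nth 0 env n
  | ZmodZero => 0
  | ZmodAdd e1 e2 => zmod_eval env e1 + zmod_eval env e2
  | ZmodOpp e1 => - zmod_eval env e1
  end.

Fixpoint zmod_coef (e : zmod_expr) (i : nat) : int :=
  match e with
  | ZmodVar n => Posz (i == n)
  | ZmodZero => 0
  | ZmodAdd e1 e2 => zmod_coef e1 i + zmod_coef e2 i
  | ZmodOpp e1 => - zmod_coef e1 i
  end.

Lemma zmod_evalE (V : zmodType) (env : seq V) (e : zmod_expr) :
  zmod_eval env e = \sum_(i < size env) nth 0 env i *~ zmod_coef e i.
Proof.
elim: e => [n||e1 IH1 e2 IH2|e1 IH1] /=.
- have [n_env|env_n] := ltnP n (size env).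
    rewrite (bigD1 (Ordinal n_env)) //= eqxx mulr1z big1 ?addr0 // => i.
    by rewrite -val_eqE /= => /negPf ->; rewrite mulr0z.
  rewrite nth_default // big1 // => i _.
  by rewrite (ltn_eqF (leq_trans (ltn_ord i) env_n)) mulr0z.
- by rewrite big1.
- by rewrite IH1 IH2 -big_split; apply: eq_bigr => i _; rewrite mulrzDr.
- by rewrite IH1 -sumrN; apply: eq_bigr => i _; rewrite mulrNz.
Qed.

Lemma zmod_eval_eq (V : zmodType) (env : seq V) (e1 e2 : zmod_expr) :
  all (fun i => zmod_coef e1 i == zmod_coef e2 i) (iota 0 (size env)) ->
  zmod_eval env e1 = zmod_eval env e2.
Proof.
move=> /allP e12; rewrite !zmod_evalE; apply: eq_bigr => i _.
by rewrite (eqP (e12 i _)) // mem_iota ltn_ord.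
Qed.

Ltac zmod_add_atom a l :=
  let rec go m :=
    lazymatch m with
    | nil => constr:(cons a l)
    | cons ?b ?m' =>
        match goal with
        (* The nested [match goal] forces [unify] to run while a term is being computed; its failure
           selects the next branch. *)
        | _ => let _ := match goal with _ => unify a b end in l
        | _ => go m'
        end
    end in go l.

Ltac zmod_atoms t l :=
  lazymatch t with
  | @GRing.add _ ?x ?y => let l' := zmod_atoms x l in zmod_atoms y l'
  | @GRing.opp _ ?x => zmod_atoms x l
  | @GRing.zero _ => l
  | _ => zmod_add_atom t l
  end.

Ltac zmod_index a l :=
  lazymatch l with
  | cons ?b ?l' =>
      match goal with
      | _ => let _ := match goal with _ => unify a b end in constr:(0%N)
      | _ => let n := zmod_index a l' in constr:(S n)
      end
  end.

Ltac zmod_reify t l :=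
  lazymatch t with
  | @GRing.add _ ?x ?y =>
      let ex := zmod_reify x l in let ey := zmod_reify y l in
      constr:(ZmodAdd ex ey)
  | @GRing.opp _ ?x => let ex := zmod_reify x l in constr:(ZmodOpp ex)
  | @GRing.zero _ => constr:(ZmodZero)
  | _ => let n := zmod_index t l in constr:(ZmodVar n)
  end.

(* Atoms are compared up to conversion, since the same operation may occur
   through different structure instances. *)
Ltac zmod :=
  lazymatch goal with
  | |- @eq ?V ?x ?y =>
      let l0 := constr:(@nil V) in
      let l1 := zmod_atoms x l0 in
      let l := zmod_atoms y l1 in
      let ex := zmod_reify x l in
      let ey := zmod_reify y l in
      apply: (@zmod_eval_eq _ l ex ey); vm_compute; reflexivity
  end.

(** * The norm as a real number *)

Section StarRing.
Context {A : starRngType}.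
Implicit Types a b c : A.

Lemma cmulNr a b : (- a) ** b = - (a ** b).
Proof. by apply: (addrI (a ** b)); rewrite -cmulDl !subrr cmul0r. Qed.

Lemma cmulrN a b : a ** (- b) = - (a ** b).
Proof. by apply: (addrI (a ** b)); rewrite -cmulDr !subrr cmulr0. Qed.

Lemma cmulBl a b c : (a - b) ** c = a ** c - b ** c.
Proof. by rewrite cmulDl cmulNr. Qed.

Lemma cmulBr a b c : c ** (a - b) = c ** a - c ** b.
Proof. by rewrite cmulDr cmulrN. Qed.

Lemma starN a : star (- a) = - star a.
Proof. by apply: (addrI (star a)); rewrite -starD !subrr star0. Qed.

Lemma starB a b : star (a - b) = star a - star b.
Proof. by rewrite starD starN. Qed.

End StarRing.

Section RealNorm.
Context {R : realType} {A : cstarAlgType R}.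
Implicit Types a b c : A.

(** Moving the norm from [R[i]] to [R] gives access to a total order and to [lra]. *)
Definition nrm a : R := complex.Re `|a|.

Lemma nrmE a : `|a| = (nrm a)%:C%C.
Proof. by rewrite /nrm RRe_real // normr_real. Qed.

Lemma nrm_ge0 a : 0 <= nrm a.
Proof. by rewrite -lecR -nrmE normr_ge0. Qed.

Lemma nrm0 : nrm 0 = 0.
Proof. by rewrite /nrm normr0. Qed.

Lemma nrm0_eq0 a : nrm a = 0 -> a = 0.
Proof. by move=> h; apply: normr0_eq0; rewrite nrmE h. Qed.

Lemma nrm_gt0 a : a != 0 -> 0 < nrm a.
Proof. by rewrite lt0r nrm_ge0 andbT; apply: contra_neq; exact: nrm0_eq0. Qed.

Lemma nrmD a b : nrm (a + b) <= nrm a + nrm b.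
Proof. by rewrite -lecR rmorphD /= -!nrmE ler_normD. Qed.

Lemma nrmN a : nrm (- a) = nrm a.
Proof. by rewrite /nrm normrN. Qed.

Lemma nrmB a b : nrm (a - b) <= nrm a + nrm b.
Proof. by rewrite -[nrm b]nrmN nrmD. Qed.

Lemma nrmBC a b : nrm (a - b) = nrm (b - a).
Proof. by rewrite -nrmN opprB. Qed.

Lemma nrm_sum n (F : 'I_n -> A) : nrm (\sum_i F i) <= \sum_i nrm (F i).
Proof.
elim/big_rec2: _ => [|i y x _ le_xy]; first by rewrite nrm0.
by apply: le_trans (nrmD _ _) _; rewrite lerD2l.
Qed.

Lemma nrmM a b : nrm (a ** b) <= nrm a * nrm b.
Proof. by rewrite -lecR rmorphM /= -!nrmE cnormM. Qed.

Lemma nrmZ (k : R[i]) a : nrm (k *: a) = complex.Re `|k| * nrm a.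
Proof.
apply: complexI; rewrite rmorphM /= -!nrmE normrZ.
by rewrite [X in X * _](_ : _ = `|k|) // RRe_real // normr_real.
Qed.

Lemma nrmZr (k : R) a : nrm (k%:C%C *: a) = `|k| * nrm a.
Proof. by rewrite nrmZ normc_def /= expr0n addr0 sqrtr_sqr. Qed.

Lemma nrmZV (k : R) a : 0 < k -> nrm (k^-1%:C%C *: a) = nrm a / k.
Proof. by move=> k0; rewrite nrmZr gtr0_norm ?invr_gt0 // mulrC. Qed.

Lemma nrm_half a : nrm (2^-1%:C%C *: a) = nrm a / 2.
Proof. by rewrite nrmZV. Qed.

Lemma scale_half_double a : 2^-1%:C%C *: a + 2^-1%:C%C *: a = a.
Proof.
rewrite -scalerDl -rmorphD /= (_ : 2^-1 + 2^-1 = 1 :> R) ?scale1r //; lra.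
Qed.

Lemma nrmZi a : nrm ('i%C *: a) = nrm a.
Proof. by rewrite nrmZ normc_def /= expr0n expr1n add0r sqrtr1 mul1r. Qed.

Lemma nrm_starl a : nrm (star a ** a) = nrm a ^+ 2.
Proof. by apply: complexI; rewrite rmorphXn /= -!nrmE cnorm_star. Qed.

Lemma nrm_star_le a : nrm a <= nrm (star a).
Proof.
have [->|a0] := eqVneq a 0; first by rewrite star0.
have pa := nrm_gt0 a0.
by rewrite -(ler_pM2r pa) -expr2 -nrm_starl nrmM.
Qed.

Lemma nrm_star a : nrm (star a) = nrm a.
Proof.
by apply/eqP; rewrite eq_le nrm_star_le -{2}[a]starK nrm_star_le.
Qed.

Lemma nrm_starr a : nrm (a ** star a) = nrm a ^+ 2.
Proof. by rewrite -{1}[a]starK nrm_starl nrm_star. Qed.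

(** The C*-identity recovers the norm of a from [a ** star a]. Unitaries of the unitization, which
    is never built, are shown to act isometrically this way. *)
Lemma nrm_eq_starr a b : a ** star a = b ** star b -> nrm a = nrm b.
Proof.
move=> e; apply/eqP; rewrite -(@eqrXn2 _ 2) ?nrm_ge0 //.
by rewrite -!nrm_starr e.
Qed.


(** Testing with [b = star a] gives |a|^2 <= C |a|. This replaces evaluating right multiplication at
    a unit. *)
Lemma nrm_le_mult (C : R) a :
  0 <= C -> (forall b, nrm (b ** a) <= C * nrm b) -> nrm a <= C.
Proof.
move=> C0 h; have [->|a0] := eqVneq a 0; first by rewrite nrm0.
have pa := nrm_gt0 a0.
by have := h (star a); rewrite nrm_starl nrm_star expr2 ler_pM2r.
Qed.

Lemma lt_exp2 (x : R) : exists k, x < 2 ^+ k.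
Proof. by exists (Num.bound x); apply: upper_nthrootP. Qed.

Lemma le_geometric (y z C : R) : (forall k, y <= z + C / 2 ^+ k) -> y <= z.
Proof.
move=> h; rewrite leNgt -subr_gt0; apply/negP => yz.
have [k] := lt_exp2 (C / (y - z)); rewrite ltr_pdivrMr // mulrC.
by rewrite -ltr_pdivrMr ?exprn_gt0 // ltrBrDl ltNge h.
Qed.

Lemma squeeze0 (C : R) a : (forall k, nrm a <= C / 2 ^+ k) -> a = 0.
Proof.
move=> h; apply: nrm0_eq0; apply/eqP; rewrite eq_le nrm_ge0 andbT.
by apply: (le_geometric (C := C)) => k; rewrite add0r.
Qed.

Lemma geometric_cvg (u : nat -> A) (C : R) :
  (forall k, nrm (u k.+1 - u k) <= C / 2 ^+ k) ->
  exists l, forall k, nrm (l - u k) <= 2 * C / 2 ^+ k.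
Proof.
move=> hu.
(* The bound is the exact sum of the C / 2^j for k <= j < k + m, so the induction closes. *)
have tele k m :
    nrm (u (k + m)%N - u k) <= 2 * C / 2 ^+ k - 2 * C / 2 ^+ (k + m).
  elim: m => [|m IH]; first by rewrite addn0 !subrr nrm0.
  rewrite addnS -[u _ - _](subrKA (u (k + m)%N)).
  apply: le_trans (nrmD _ _) _; apply: le_trans (lerD (hu _) IH) _.
  rewrite exprS invfM; lra.
have C0 : 0 <= C.
  by apply: le_trans (nrm_ge0 _) _; rewrite -[C]divr1; exact: (hu 0%N).
have tail k m : nrm (u (k + m)%N - u k) <= 2 * C / 2 ^+ k.
  apply: le_trans (tele k m) _.
  by rewrite gerBl divr_ge0 ?mulr_ge0 ?exprn_ge0.
have /cauchy_cvgP/cvg_ex[l ul] : cauchy (u @ \oo)%classic.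
  apply/cauchy_exP => e e0.
  have [er er0] : exists2 r : R, 0 < r & e = r%:C%C.
    exists (complex.Re e); first by move: e0; rewrite ltcE => /andP[].
    by rewrite RRe_real // gtr0_real.
  move=> ->; have [k] := lt_exp2 (2 * C / er).
  rewrite ltr_pdivrMr // [ltRHS]mulrC -ltr_pdivrMr ?exprn_gt0 // => lk.
  exists (u k), k => // n /= kn.
  rewrite -ball_normE /= nrmE ltcR nrmBC -(subnKC kn).
  exact: le_lt_trans (tail _ _) lk.
exists l => k; apply/ler_addgt0Pr => e e0.
have e0C : 0 < e%:C%C :> R[i] by rewrite ltcR.
move/cvgrPdist_lt: ul => /(_ _ e0C) [n _ hn].
have := hn (k + n)%N; rewrite /= leq_addl => /(_ isT).
rewrite nrmE ltcR => h.
rewrite -[l - _](subrKA (u (k + n)%N)) [leRHS]addrC.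
by apply: le_trans (nrmD _ _) _; apply: lerD (ltW h) (tail _ _).
Qed.

(** Iteration from [x0] stands in for inverses and square roots. [S] carries side conditions such as
    commutation or a norm bound; it need only be closed under geometrically fast limits, the kind
    the iteration produces. *)
Lemma contraction_fixpoint (S : A -> Prop) (F : A -> A) (x0 : A) :
  S x0 -> (forall x, S x -> S (F x)) ->
  (forall u l (C : R), (forall k, S (u k)) ->
    (forall k, nrm (l - u k) <= C / 2 ^+ k) -> S l) ->
  (forall x y, S x -> S y -> nrm (F x - F y) <= nrm (x - y) / 2) ->
  exists2 x, S x & F x = x.
Proof.
move=> S0 SF Scl Flip; pose u k := iter k F x0.
have Su k : S (u k) by elim: k => //= k; exact: SF.
have hu k : nrm (u k.+1 - u k) <= nrm (F x0 - x0) / 2 ^+ k.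
  elim: k => [|k IH]; first by rewrite expr0 divr1.
  apply: le_trans (Flip (u k.+1) (u k) (Su _) (Su _)) _.
  by rewrite exprSr invfM mulrA ler_pM2r ?invr_gt0.
have [l ul] := geometric_cvg hu; have Sl := Scl _ _ _ Su ul.
exists l => //; apply/eqP; rewrite -subr_eq0; apply/eqP.
apply: (squeeze0 (C := 2 * nrm (F x0 - x0))) => k.
rewrite -[_ - l](subrKA (u k.+1)); apply: le_trans (nrmD _ _) _.
rewrite [nrm (u _ - l)]nrmBC.
apply: le_trans (lerD (Flip l (u k) Sl (Su k)) (ul k.+1)) _.
have := ul k; rewrite exprS invfM; lra.
Qed.

End RealNorm.

(** * Approximate units *)

Section ApproximateUnit.
Context {R : realType} {A : cstarAlgType R}.
Implicit Types a b c e t w x : A.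

Lemma nrm_eq_starl a b : star a ** a = star b ** b -> nrm a = nrm b.
Proof.
rewrite -[nrm a]nrm_star -[nrm b]nrm_star => h; apply: nrm_eq_starr.
by rewrite !starK.
Qed.

Lemma zmod_double_inj a b : a + a = b + b -> a = b.
Proof.
move=> h; apply: (@scalerI _ A (2%:R : R[i])); first by rewrite pnatr_eq0.
by rewrite !scaler_nat !mulr2n.
Qed.

Lemma nrm_double a : nrm (a + a) = 2 * nrm a.
Proof.
by rewrite -mulr2n -scaler_nat -(rmorph_nat (real_complex R)) nrmZr normr_nat.
Qed.

Lemma starZr (r : R) a : star (r%:C%C *: a) = r%:C%C *: star a.
Proof. by rewrite starZ; congr (_ *: _); exact: conjc_real. Qed.

Lemma starZi a : star ('i%C *: a) = - ('i%C *: star a).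
Proof.
rewrite starZ -scaleNr; congr (_ *: _).
by apply/eqP; rewrite eq_complex /= oppr0 !eqxx.
Qed.

Lemma comm_closed x (u : nat -> A) l (C : R) :
  (forall k, x ** u k = u k ** x) ->
  (forall k, nrm (l - u k) <= C / 2 ^+ k) -> x ** l = l ** x.
Proof.
move=> xu ul; apply/eqP; rewrite -subr_eq0; apply/eqP.
apply: (squeeze0 (C := 2 * nrm x * C)) => k.
have -> : x ** l - l ** x = x ** (l - u k) - (l - u k) ** x.
  by rewrite cmulBr cmulBl xu; zmod.
apply: le_trans (nrmB _ _) _; apply: le_trans (lerD (nrmM _ _) (nrmM _ _)) _.
have := ler_wpM2l (nrm_ge0 x) (ul k); lra.
Qed.

(* [1 + w] is the Cayley transform [(1 + t) (1 - t)^-1]. *)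
Lemma cayley_ex t : nrm t <= 1 / 2 ->
  exists2 w, w = t + t + t ** w & w = t + t + w ** t.
Proof.
(* The map is 1/2-Lipschitz as |t| <= 1/2; the invariant [t ** w = w ** t] gives the second form of
   the equation. *)
move=> t2; have [||||w tw ww] := @contraction_fixpoint R A
    (fun w => t ** w = w ** t) (fun w => t + t + t ** w) 0.
- by rewrite cmulr0 cmul0r.
- by move=> w tw; rewrite cmulDr cmulDl cmulDl cmulDr -cmulA tw.
- by move=> u l C; exact: comm_closed.
- move=> x y _ _.
  have -> : t + t + t ** x - (t + t + t ** y) = t ** (x - y).
    by rewrite cmulBr; zmod.
  apply: le_trans (nrmM _ _) _; have := ler_wpM2r (nrm_ge0 (x - y)) t2; lra.
by exists w; rewrite -?tw ww.
Qed.

(** The Cayley transform of a skew-adjoint t is an isometry: the conclusion is (1 + w)^* (1 + w) = 1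
    multiplied out. *)
Lemma cayley_unitary t w : star t = - t -> w = t + t + t ** w ->
  star w ** w = - (w + star w).
Proof.
move=> ts wt.
have tw : t ** w = w - (t + t) by rewrite {2}wt; zmod.
have ws : star w = - (t + t) - star w ** t.
  by rewrite {1}wt !starD starM ts cmulrN; zmod.
have wst : star w ** t = - (t + t) - star w by rewrite {2}ws; zmod.
(* Expanding w in one copy and [star w] in the other makes the cubic terms [star w ** t ** w]
   cancel. *)
apply: zmod_double_inj.
rewrite -[X in X + _](_ : star w ** (t + t + t ** w) = _); last by rewrite -wt.
rewrite -[X in _ + X](_ : (- (t + t) - star w ** t) ** w = _);
  last by rewrite -ws.
rewrite !(cmulDr, cmulDl, cmulNr, cmulrN) cmulA.
transitivity (star w ** t + star w ** t - (t ** w + t ** w)); first by zmod.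
by rewrite wst tw; zmod.
Qed.

Lemma isometry_mulr w b : w ** star w = - (w + star w) ->
  nrm (b + b ** w) = nrm b.
Proof.
move=> ww; apply: nrm_eq_starr; rewrite starD starM cmulDl !cmulDr.
rewrite !cmulA -[b ** w ** star w]cmulA ww cmulrN cmulDr cmulNr cmulDl.
by zmod.
Qed.

Lemma isometry_mull w b : star w ** w = - (w + star w) ->
  nrm (b + w ** b) = nrm b.
Proof.
move=> ww; apply: nrm_eq_starl; rewrite starD starM cmulDl !cmulDr.
rewrite !cmulA -[_ ** star w ** w]cmulA ww cmulrN cmulDr cmulNr cmulDl.
by zmod.
Qed.

(** Unit-free way to say that multiplication by 1 - e is contractive on both sides. *)
Definition cocontraction e :=
  (forall b, nrm (b - b ** e) <= nrm b) /\
  (forall b, nrm (b - e ** b) <= nrm b).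

Lemma cocontraction0 : cocontraction 0.
Proof. by split=> b; rewrite ?cmul0r ?cmulr0 subr0. Qed.

Lemma cocontraction_star e : cocontraction e -> cocontraction (star e).
Proof.
by move=> [er el]; split=> b;
  rewrite -nrm_star starB starM starK -[leRHS]nrm_star ?er ?el.
Qed.

(** (1 - e) (1 - f) = 1 - (e + f - e f). *)
Lemma cocontraction_comp e f :
  cocontraction e -> cocontraction f -> cocontraction (e + f - e ** f).
Proof.
move=> [er el] [fr fl]; split=> b.
  have -> : b - b ** (e + f - e ** f) = (b - b ** e) - (b - b ** e) ** f.
    by rewrite !(cmulDr, cmulDl, cmulNr, cmulrN) cmulA; zmod.
  exact: le_trans (fr _) (er _).
have -> : b - (e + f - e ** f) ** b = (b - f ** b) - e ** (b - f ** b).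
  by rewrite !(cmulDr, cmulDl, cmulNr, cmulrN) cmulA; zmod.
exact: le_trans (el _) (fl _).
Qed.

Lemma cocontraction_nrm e : cocontraction e -> nrm e <= 2.
Proof.
move=> [er _]; apply: nrm_le_mult => // b.
rewrite (_ : b ** e = b - (b - b ** e)); last by zmod.
by apply: le_trans (nrmB _ _) _; have := er b; lra.
Qed.

(* With [1 + w] unitary, [1 - e] is the average of its first [M] powers: then
   [w - w e = ((1 + w)^M - 1) / M] and [2 (t - t e) = (1 - t) (w - w e)]. *)
Lemma cocontraction_skew t (M : nat) : star t = - t -> nrm t <= 1 / 2 ->
  (0 < M)%N -> exists2 e, cocontraction e & nrm (t - t ** e) <= 2 / M%:R.
Proof.
move=> ts t2 M0; have [w wt wt'] := cayley_ex t2.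
have wsw : star w ** w = - (w + star w) by exact: cayley_unitary ts wt.
(* [star w] is the Cayley transform of -t, whence the identity with the factors exchanged. *)
have wws : w ** star w = - (w + star w).
  rewrite -{1}[w]starK (@cayley_unitary (- t)) ?starN ?ts //.
    by rewrite starK addrC.
  by rewrite {1}wt' !starD starM ts.
(* 1 + v_j = (1 + w)^j. *)
pose v j := iter j (fun v => v + w + w ** v) 0.
have vr j : forall b, nrm (b + b ** v j) = nrm b.
  elim: j => [|j IH] b /=; first by rewrite cmulr0 addr0.
  rewrite -(isometry_mulr b wws) -(IH (b + b ** w)); congr nrm.
  by rewrite !(cmulDr, cmulDl) cmulA; zmod.
have vl j b : nrm (b + v j ** b) = nrm b.
  elim: j => [|j IH] /=; first by rewrite cmul0r addr0.
  rewrite -IH -(isometry_mull (b + v j ** b) wsw); congr nrm.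
  by rewrite !(cmulDr, cmulDl) cmulA; zmod.
pose m : R := M%:R; have m0 : 0 < m by rewrite ltr0n.
have mM (F : nat -> A) b :
    b + m^-1%:C%C *: (\sum_(j < M) F j) = m^-1%:C%C *: (\sum_(j < M) (b + F j)).
  rewrite big_split /= scalerDr sumr_const card_ord -scaler_nat scalerA.
  by rewrite -(rmorph_nat (real_complex R)) -rmorphM mulVf ?gt_eqF //= scale1r.
have avg (F : nat -> A) b : (forall j, nrm (b + F j) = nrm b) ->
    nrm (b + m^-1%:C%C *: (\sum_(j < M) F j)) <= nrm b.
  move=> Fb; rewrite mM nrmZV // ler_pdivrMr //.
  apply: le_trans (nrm_sum _) _; under eq_bigr do rewrite Fb.
  by rewrite sumr_const card_ord mulr_natr.
pose e := - (m^-1%:C%C *: \sum_(j < M) v j).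
have eR b : b - b ** e = b + m^-1%:C%C *: (\sum_(j < M) b ** v j).
  by rewrite cmulrN opprK -cscalerAr cmul_sumr.
have eL b : b - e ** b = b + m^-1%:C%C *: (\sum_(j < M) v j ** b).
  by rewrite cmulNr opprK -cscalerAl cmul_suml.
exists e.
  split=> b.
    by rewrite eR; apply: (avg (fun j => b ** v j)) => j; exact: vr.
  by rewrite eL; apply: (avg (fun j => v j ** b)) => j; exact: vl.
have we : nrm (w - w ** e) <= 2 / m.
  rewrite eR (mM (fun j => w ** v j)) nrmZV //.
  rewrite ler_pM2r ?invr_gt0 //.
  (* w + w v_j = v_(j+1) - v_j, so the sum telescopes. *)
  have -> : \sum_(j < M) (w + w ** v j) = v M.
    elim: (M) => [|k IH]; first by rewrite big_ord0.
    by rewrite big_ord_recr IH /=; zmod.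
  apply: nrm_le_mult => // b.
  rewrite (_ : b ** v M = (b + b ** v M) - b); last by zmod.
  by apply: le_trans (nrmB _ _) _; rewrite vr; lra.
have dt : (t - t ** e) + (t - t ** e) = (w - w ** e) - t ** (w - w ** e).
  rewrite cmulBr cmulA.
  have -> : t ** w = w - (t + t) by rewrite {2}wt; zmod.
  by rewrite cmulBl cmulDl; zmod.
have := nrm_double (t - t ** e); rewrite dt => td.
have := nrmB (w - w ** e) (t ** (w - w ** e)).
have := nrmM t (w - w ** e); have := ler_wpM2r (nrm_ge0 (w - w ** e)) t2.
have := nrm_ge0 (w - w ** e); rewrite -/m; lra.
Qed.

(** With t a multiple of i b^* b, |b (1 - e)|^2 = |(1 - e)^* b^* b (1 - e)| is at most |b^* b (1 -
    e)|, a multiple of |t - t e|. *)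
Lemma cocontraction_approx b (eps : R) : 0 < eps ->
  exists2 e, cocontraction e & nrm (b - b ** e) <= eps.
Proof.
(* This s makes |t| <= 1/2, the [+ 1] covering b = 0; M below then gives 2 s / M <= eps^2. *)
move=> eps0; pose s : R := 2 * (nrm b ^+ 2 + 1).
have s0 : 0 < s by rewrite mulr_gt0 // ltr_wpDl ?sqr_ge0.
pose t := 'i%C *: (s^-1%:C%C *: (star b ** b)).
pose M := Num.bound (2 * s / eps ^+ 2).
have Mb : 2 * s / eps ^+ 2 < M%:R.
  by apply: archi_boundP; rewrite divr_ge0 ?sqr_ge0 // mulr_ge0 // ltW.
have M0 : (0 < M)%N.
  rewrite -(ltr0n R); apply: le_lt_trans _ Mb.
  by rewrite divr_ge0 ?sqr_ge0 // mulr_ge0 // ltW.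
have [|||e [er el] te] := @cocontraction_skew t M _ _ _.
- by rewrite /t starZi starZr starM starK.
- rewrite /t nrmZi nrmZr nrm_starl gtr0_norm ?invr_gt0 // mulrC ler_pdivrMr //.
  by rewrite /s; lra.
- by [].
exists e => //; have := te.
have -> : t - t ** e = 'i%C *: (s^-1%:C%C *: (star b ** b - star b ** b ** e)).
  by rewrite !scalerBr /t -!cscalerAl.
rewrite nrmZi nrmZV // ler_pdivrMr // => ze.
rewrite -(ler_pXn2r (n := 2)) ?nnegrE ?nrm_ge0 ?(ltW eps0) // -nrm_starl.
have -> : star (b - b ** e) ** (b - b ** e) = (star b ** b - star b ** b ** e)
    - star e ** (star b ** b - star b ** b ** e).
  by rewrite starB starM !(cmulBl, cmulBr) !cmulA; zmod.
have [_ es] := cocontraction_star (conj er el).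
apply: le_trans (es _) _; apply: le_trans ze _.
move: Mb; rewrite ltr_pdivrMr ?exprn_gt0 // => /ltW.
by rewrite mulrAC ler_pdivrMr ?ltr0n // [leRHS]mulrC.
Qed.

(** Elements are treated one at a time: a further contractive factor 1 - f keeps the estimates
    already reached. For [a], multiplied on the other side, [star a] is approximated and adjoints
    are taken. *)
Lemma cocontraction_approx_fin (I : finType) (c : I -> A) a (eps : R) :
  0 < eps -> exists e, [/\ cocontraction e,
    forall i, nrm (c i - c i ** e) <= eps & nrm (a - e ** a) <= eps].
Proof.
move=> eps0.
have [e ce ec] : exists2 e, cocontraction e &
    forall i, i \in enum I -> nrm (c i - c i ** e) <= eps.
  elim: (enum I) => [|i s [e ce ec]].
    by exists 0 => //; exact: cocontraction0.
  have [f cf fc] := cocontraction_approx (c i - c i ** e) eps0.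
  exists (e + f - e ** f); first exact: cocontraction_comp.
  move=> j; rewrite inE.
  have -> : c j - c j ** (e + f - e ** f)
      = (c j - c j ** e) - (c j - c j ** e) ** f.
    by rewrite !(cmulDr, cmulDl, cmulNr, cmulrN) cmulA; zmod.
  case/predU1P => [->//|js]; apply: le_trans (ec j js); exact: cf.1.
have [f cf fa] := cocontraction_approx (star a) eps0.
have cf' := cocontraction_star cf.
exists (e + star f - e ** star f); split; first exact: cocontraction_comp.
  move=> i; have -> : c i - c i ** (e + star f - e ** star f)
      = (c i - c i ** e) - (c i - c i ** e) ** star f.
    by rewrite !(cmulDr, cmulDl, cmulNr, cmulrN) cmulA; zmod.
  by apply: le_trans (cf'.1 _) _; apply: ec; rewrite mem_enum.
have -> : a - (e + star f - e ** star f) ** a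
    = (a - star f ** a) - e ** (a - star f ** a).
  by rewrite !(cmulDr, cmulDl, cmulNr, cmulrN) cmulA; zmod.
apply: le_trans (ce.2 _) _.
by rewrite -nrm_star starB starM starK.
Qed.
End ApproximateUnit.

(** * Cohen factorization *)

Section Factorization.
Context {R : realType} {A : cstarAlgType R}.
Implicit Types a b c e : A.

(** (1 + e) / 2 = 1 - (1 - e) / 2 can be divided out by iteration, since 1 - e is contractive. *)
Lemma cocontraction_solve c e (eps : R) : cocontraction e ->
  nrm (c - c ** e) <= eps ->
  exists c', c = 2^-1%:C%C *: (c' + c' ** e) /\ nrm (c' - c) <= eps.
Proof.
move=> [er _] ce; pose h : R[i] := (2^-1 : R)%:C%C.
have [||||c' _ c'E] := @contraction_fixpoint R A (fun=> True)
    (fun y => c + h *: (y - y ** e)) 0.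
- by [].
- by [].
- by [].
- move=> x y _ _.
  have -> : c + h *: (x - x ** e) - (c + h *: (y - y ** e))
      = h *: ((x - y) - (x - y) ** e).
    by rewrite !(scalerBr, cmulBl); zmod.
  by rewrite nrm_half ler_pM2r ?invr_gt0.
have c'c : c' - c = h *: (c' - c' ** e) by rewrite -{1}c'E; zmod.
exists c'; split.
  transitivity (c' - (c' - c)); first by zmod.
  by rewrite c'c -/h -{1}[c']scale_half_double scalerBr scalerDr; zmod.
have := nrm_half (c' - c' ** e); rewrite -c'c => c'cN.
(* z = c' - c' e satisfies |z| <= eps + |z| / 2, so |c' - c| = |z| / 2 <= eps. *)
have zE : c' - c' ** e
    = (c - c ** e) + h *: ((c' - c' ** e) - (c' - c' ** e) ** e).
  by rewrite scalerBr cscalerAl -c'c cmulBl; zmod.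
have := nrmD (c - c ** e) (h *: ((c' - c' ** e) - (c' - c' ** e) ** e)).
rewrite -zE nrm_half; have := er (c' - c' ** e); lra.
Qed.

Lemma cohen_step (I : finType) (c : I -> A) a (s eps : R) :
  0 <= s -> 0 < eps ->
  exists c' : I -> A, exists a', [/\
    forall i, s%:C%C *: c i + c i ** a
      = (s / 2)%:C%C *: c' i + c' i ** a',
    forall i, nrm (c' i - c i) <= eps & nrm (a' - a) <= eps + s].
Proof.
move=> s0 eps0.
have [e [ce ec ea]] := cocontraction_approx_fin c a eps0.
have [c' c'E] := choice (fun i => cocontraction_solve ce (ec i)).
pose h : R[i] := (2^-1 : R)%:C%C.
(* Chosen so that s / 2 + a' = (1 + e) / 2 (s + a). *)
exists c', (h *: (a + e ** a + s%:C%C *: e)); split=> [i|i|].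
- have [-> _] := c'E i; rewrite -/h -cscalerAl -cscalerAr.
  rewrite scalerA [s%:C%C * h]mulrC -scalerA rmorphM /= -/h.
  rewrite [s%:C%C * h]mulrC -scalerA -!scalerDr; congr (_ *: _).
  by rewrite cmulDl !cmulDr -cscalerAr scalerDr cmulA; zmod.
- by have [] := c'E i.
have -> : h *: (a + e ** a + s%:C%C *: e) - a
    = h *: (- (a - e ** a)) + h *: (s%:C%C *: e).
  rewrite -[X in _ - X = _]scale_half_double.
  by rewrite !(scalerDr, scalerBr, scalerN); zmod.
apply: le_trans (nrmD _ _) _; rewrite !nrm_half nrmN nrmZr ger0_norm //.
have := ler_wpM2l s0 (cocontraction_nrm ce); lra.
Qed.

(* Maintain [b = c_k (2^-k + a_k)]: each step multiplies [2^-k + a_k] on the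
   left by [(1 + e) / 2] and divides [c_k] by it on the right. *)
Theorem cohen_factorization (I : finType) (b : I -> A) :
  exists c : I -> A, exists e, forall i, b i = c i ** e.
Proof.
have pow0 k : 0 < (2 ^+ k)^-1 :> R by rewrite invr_gt0 exprn_gt0.
have /choice[f fP] : forall p : nat * ((I -> A) * A), exists q : (I -> A) * A,
    [/\ forall i, (2 ^+ p.1)^-1%:C%C *: p.2.1 i + p.2.1 i ** p.2.2
          = (2 ^+ p.1.+1)^-1%:C%C *: q.1 i + q.1 i ** q.2,
        forall i, nrm (q.1 i - p.2.1 i) <= 1 / 2 ^+ p.1 &
        nrm (q.2 - p.2.2) <= 2 / 2 ^+ p.1].
  move=> [k [c a]] /=.
  have [c' [a' [h1 h2 h3]]] := cohen_step c a (ltW (pow0 k)) (pow0 k).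
  exists (c', a'); split=> /= [i|i|].
  - by rewrite h1 exprSr invfM.
  - by rewrite div1r.
  - by apply: le_trans h3 _; rewrite mulrDl mul1r.
pose u := fix u k := if k is k'.+1 then f (k', u k') else (b, 0).
have bE k i : b i = (2 ^+ k)^-1%:C%C *: (u k).1 i + (u k).1 i ** (u k).2.
  elim: k => [|k ->] /=; first by rewrite expr0 invr1 scale1r cmulr0 addr0.
  by have [/(_ i)] := fP (k, u k).
have /choice[c cP] : forall i, exists l, forall k,
    nrm (l - (u k).1 i) <= 2 * 1 / 2 ^+ k.
  by move=> i; apply: (geometric_cvg (u := fun k => (u k).1 i)) => k;
    have [_ /(_ i)] := fP (k, u k).
have [a aP] : exists l, forall k, nrm (l - (u k).2) <= 2 * 2 / 2 ^+ k.
  by apply: (geometric_cvg (u := fun k => (u k).2)) => k;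
    have [_ _] := fP (k, u k).
exists c, a => i; apply/eqP; rewrite -subr_eq0; apply/eqP.
(* The three summands bound |c_k|, 2^k |c - c_k| |a_k| and 2^k |c| |a - a_k|. *)
apply: (squeeze0 (C := (nrm (c i) + 2) + 2 * (nrm a + 4) + 4 * nrm (c i))) => k.
set ck := (u k).1 i; set ak := (u k).2.
have -> : b i - c i ** a = (2 ^+ k)^-1%:C%C *: ck
    - (c i - ck) ** ak - c i ** (a - ak).
  by rewrite (bE k) -/ck -/ak cmulBl cmulBr; zmod.
have le1 : (2 ^+ k)^-1 <= 1 :> R.
  by rewrite invf_le1 ?exprn_gt0 ?exprn_ege1 // ler1n.
have cn : nrm ck <= nrm (c i) + 2.
  rewrite (_ : ck = c i - (c i - ck)); last by zmod.
  apply: le_trans (nrmB _ _) _; have := cP i k; rewrite -/ck; lra.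
have an : nrm ak <= nrm a + 4.
  rewrite (_ : ak = a - (a - ak)); last by zmod.
  apply: le_trans (nrmB _ _) _; have := aP k; rewrite -/ak; lra.
apply: le_trans (nrmB _ _) _; rewrite [leRHS]mulrDl.
apply: lerD; last first.
  apply: le_trans (nrmM _ _) _.
  have := ler_wpM2l (nrm_ge0 (c i)) (aP k); rewrite -/ak; lra.
apply: le_trans (nrmB _ _) _; rewrite [leRHS]mulrDl.
apply: lerD.
  by rewrite nrmZr gtr0_norm // mulrC ler_pM2r.
apply: le_trans (nrmM _ _) _.
apply: le_trans (ler_pM (nrm_ge0 _) (nrm_ge0 _) (cP i k) an) _; lra.
Qed.

Lemma cohen_factorization_iter (I : finType) (m : nat) (b : I -> A) :
  exists c : I -> A, exists2 s : seq A, size s = m &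
    forall i, b i = cprod (c i) s.
Proof.
elim: m b => [|m IH] b; first by exists b, [::].
have [c [e bE]] := cohen_factorization b.
have [c' [s sm cE]] := IH c.
exists c', (rcons s e); first by rewrite size_rcons sm.
by move=> i; rewrite bE cE /cprod foldl_rcons.
Qed.

End Factorization.

(** * Words and n-homomorphisms *)

Section Words.
Context {A : starRngType}.
Implicit Types (a b x : A) (s t : seq A).

Lemma cprod_cat a s t : cprod a (s ++ t) = cprod (cprod a s) t.
Proof. exact: foldl_cat. Qed.

Lemma cprodDl a b s : cprod (a + b) s = cprod a s + cprod b s.
Proof. by elim: s a b => //= x s IH a b; rewrite -IH -cmulDl. Qed.

Lemma cprodBl a b s : cprod (a - b) s = cprod a s - cprod b s.
Proof. by elim: s a b => //= x s IH a b; rewrite -IH -cmulBl. Qed.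

Lemma cprod_rcons a s x : cprod a (rcons s x) = cprod a s ** x.
Proof. exact: foldl_rcons. Qed.

Lemma cmul_cprod a b s : a ** cprod b s = cprod (a ** b) s.
Proof. by elim/last_ind: s => //= s x IH; rewrite !cprod_rcons cmulA IH. Qed.

(** The adjoint reverses the word [a :: s], whose last letter becomes the head; the result is a
    single word, as [nhom] requires. *)
Lemma star_cprod_mul a b s t : star (cprod a s) ** cprod b t =
  cprod (star (last a s)) (map star (rev (belast a s)) ++ b :: t).
Proof.
elim/last_ind: s => [|s e IH]; first by rewrite cmul_cprod.
rewrite cprod_rcons starM -cmulA IH cmul_cprod last_rcons belast_rcons.
by rewrite [a :: s]lastI rev_rcons.
Qed.

Lemma cprod_nseqS a x m : cprod a (nseq m.+1 x) = cprod a (nseq m x) ** x.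
Proof. by rewrite -addn1 nseqD cprod_cat. Qed.

Lemma cprod_nseq_cat a x i j :
  cprod (cprod a (nseq i x)) (nseq j x) = cprod a (nseq (i + j) x).
Proof. by rewrite nseqD cprod_cat. Qed.

(** This is x^m a, while [cprod a (nseq m x)] is a x^m; carrying a lets m = 0 make sense without a
    unit. *)
Definition lpow m x a : A := iter m (cmul x) a.

Lemma lpowM m x a b : lpow m x (a ** b) = lpow m x a ** b.
Proof. by elim: m => //= m ->; rewrite cmulA. Qed.

Lemma lpowD m x a b : lpow m x (a + b) = lpow m x a + lpow m x b.
Proof. by elim: m => //= m ->; rewrite cmulDr. Qed.

Lemma lpow_comm m x a b : b ** a = a ** b -> b ** x = x ** b ->
  b ** lpow m x a = lpow m x a ** b.
Proof. by move=> ba bx; elim: m => //= m IH; rewrite cmulA bx -!cmulA IH. Qed.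

Lemma lpow_cprod m x a s : lpow m x (cprod a s) = cprod (lpow m x a) s.
Proof.
by elim/last_ind: s => //= s y IH; rewrite !cprod_rcons lpowM IH.
Qed.

Lemma lpow_self m x : lpow m x x = cprod x (nseq m x).
Proof. by elim: m => //= m ->; rewrite cmul_cprod. Qed.

Lemma cprod_nseq_mul m x a b : cprod a (nseq m x) ** b = a ** lpow m x b.
Proof.
elim: m b => // m IH b.
by rewrite cprod_nseqS -cmulA IH /lpow iterSr.
Qed.

Lemma star_lpow m x a : star x = x ->
  star (lpow m x a) = cprod (star a) (nseq m x).
Proof. by move=> xs; elim: m => // m IH; rewrite cprod_nseqS -IH starM xs. Qed.

Lemma star_cprod_nseq m x a : star x = x ->
  star (cprod a (nseq m x)) = lpow m x (star a).
Proof. by move=> xs; rewrite -[RHS]starK star_lpow // starK. Qed.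

Lemma cprod_nseq_comm m x a b : b ** a = a ** b -> b ** x = x ** b ->
  b ** cprod a (nseq m x) = cprod a (nseq m x) ** b.
Proof.
move=> ba bx; elim: m => // m IH.
by rewrite cprod_nseqS cmulA IH -!cmulA bx.
Qed.

(** Exponents shift by one: [cprod x (nseq i x)] is x^(i+1). *)
Lemma cprod_nseq_mulself i j x :
  cprod x (nseq i x) ** cprod x (nseq j x) = cprod x (nseq (i + j).+1 x).
Proof. by rewrite cmul_cprod -cprod_nseqS cprod_nseq_cat addSn. Qed.

End Words.

(** * Complete positivity *)

Section NhomPositive.
Context {R : realType} {A B : cstarAlgType R} {n : nat}.
Context {phi : {linear A -> B}}.
Hypotheses (phi_nhom : nhom n phi) (phi_inv : involutive_map phi).

Lemma nhom_star_cprod_mul (a b : A) (s t : seq A) :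
  ((size s).+1 + (size t).+1)%N = n ->
  phi (star (cprod a s) ** cprod b t) =
  star (cprod (phi a) (map phi s)) ** cprod (phi b) (map phi t).
Proof.
move=> st; rewrite !star_cprod_mul phi_nhom.
  rewrite phi_inv last_map belast_map map_cat -!map_comp -map_rev -map_comp.
  by congr (cprod _ (_ ++ _)); apply: eq_map => x /=; rewrite phi_inv.
by rewrite size_cat size_map size_rev size_belast /= -st addSn.
Qed.

Lemma nhom_completely_positive :
  (2 <= n)%N -> ~~ odd n -> completely_positive phi.
Proof.
move=> n2 n_even k _ a [b ->].
(* Indexing by all pairs gives every entry the same tail [s]. With n/2 - 1 letters in it, each entry
   is a word of n/2 letters, and its product with an adjoint has n. *)
have [c [s sm bE]] :=
  cohen_factorization_iter n./2.-1 (fun p : 'I_k * 'I_k => b p.1 p.2).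
exists (\matrix_(i, j) cprod (phi (c (i, j))) (map phi s)).
apply/matrixP => i j; rewrite !mxE linear_sum; apply: eq_bigr => l _.
rewrite !mxE (bE (l, i)) (bE (l, j)) nhom_star_cprod_mul // sm.
rewrite prednK ?half_gt0 // addnn.
by have := odd_double_half n; rewrite (negPf n_even).
Qed.

End NhomPositive.

(** * Boundedness *)

Section Bounded.
Context {R : realType}.

Lemma nrm_cprod_nseq {A : cstarAlgType R} (a x : A) m :
  nrm x <= 1 -> nrm (cprod a (nseq m x)) <= nrm a.
Proof.
move=> x1; elim: m => // m IH; rewrite cprod_nseqS.
apply: le_trans (nrmM _ _) _; apply: le_trans IH.
by rewrite ler_piMr ?nrm_ge0.
Qed.

(** With a_j = |x^(j+1)| and x nonzero, the C*-identity gives a_(m+1)^2 = |x^(2m+4)| <= a_m a_(m+2).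
    The ratios a_(m+1) / a_m thus never decrease, and they start at |x|. *)
Lemma nrm_pow_ge {A : cstarAlgType R} (x : A) m : star x = x ->
  nrm x ^+ m.+1 <= nrm (cprod x (nseq m x)).
Proof.
move=> xs; pose a j := nrm (cprod x (nseq j x)).
have [->|x0] := eqVneq x 0; first by rewrite nrm0 expr0n nrm_ge0.
have r0 := nrm_gt0 x0.
have sq j : a j ^+ 2 = a (j + j).+1.
  by rewrite /a -nrm_starl star_cprod_nseq // xs lpow_self cprod_nseq_mulself.
suff [] : nrm x ^+ m.+1 <= a m /\ nrm x * a m <= a m.+1 by [].
elim: m => [|m [IH1 IH2]]; first by split; rewrite // -(sq 0%N) expr2.
have a0 : 0 < a m by apply: lt_le_trans IH1; rewrite exprn_gt0.
split; first by rewrite exprS; apply: le_trans IH2; rewrite ler_pM2l.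
rewrite -(ler_pM2l a0); apply: (le_trans (y := a m.+1 ^+ 2)).
  by rewrite mulrA [a m * _]mulrC expr2 ler_wpM2r ?nrm_ge0.
rewrite sq (_ : (m.+1 + m.+1).+1 = (m + m.+2).+1)%N ?addSnnS //.
by rewrite /a -cprod_nseq_mulself nrmM.
Qed.

(* [q + i (1 - p)] is unitary. *)
Lemma nrm_unitary_mulr {A : cstarAlgType R} (p q b : A) :
  star p = p -> star q = q -> q ** p = p ** q -> q ** q + p ** p = p + p ->
  nrm (b ** q + 'i%C *: (b - b ** p)) = nrm b.
Proof.
move=> ps qs qp qq.
have {}qq : q ** q = p + p - p ** p by rewrite -qq; zmod.
have ii (x : A) : 'i%C *: ('i%C *: x) = - x.
  by rewrite scalerA -expr2 sqr_i scaleN1r.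
apply: nrm_eq_starr; rewrite starD starZi starB !starM ps qs.
rewrite !scalerBr !(cmulDl, cmulDr, cmulNr, cmulrN).
rewrite -!(cscalerAl, cscalerAr) !ii !cmulA -![b ** _ ** _]cmulA qq qp.
rewrite !(cmulDl, cmulDr, cmulNr, cmulrN) !cmulA.
by zmod.
Qed.

(** q + i (1 - p) and -q + i (1 - p) are both unitary, and q is half their difference. *)
Lemma nrm_commuting_circle {A : cstarAlgType R} (p q : A) :
  star p = p -> star q = q -> q ** p = p ** q -> q ** q + p ** p = p + p ->
  nrm q <= 1.
Proof.
move=> ps qs qp qq; apply: nrm_le_mult => // b; rewrite mul1r.
have := nrm_double (b ** q).
have -> : b ** q + b ** q = (b ** q + 'i%C *: (b - b ** p))
    - (b ** (- q) + 'i%C *: (b - b ** p)) by rewrite cmulrN; zmod.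
move=> e; have := nrmB (b ** q + 'i%C *: (b - b ** p))
    (b ** (- q) + 'i%C *: (b - b ** p)).
rewrite e !nrm_unitary_mulr ?starN ?qs ?cmulNr ?cmulrN ?opprK ?qp //; lra.
Qed.

(* Formally [p = x^h v x^h] solves [x^(4h+2) - 2 p + p^2 = 0], that is
   [p = 1 - sqrt (1 - x^(4h+2))]; the equation for [v] only contains words of
   length 1 and [2h+2]. *)
Lemma quadratic_fixpoint {A : cstarAlgType R} (x : A) (h : nat) :
  star x = x -> nrm x <= 1 / 2 ->
  exists v, [/\ star v = v, x ** v = v ** x &
    v + v = cprod x (nseq h.*2.+1 x) + cprod v (nseq h.*2 x) ** v].
Proof.
move=> xs x2; pose g : R[i] := (2^-1 : R)%:C%C.
have x1 : nrm x <= 1 by lra.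
(* [xn] is x^(2h+2). *)
pose xn := cprod x (nseq h.*2.+1 x).
have xnN : nrm xn <= 1 / 4.
  rewrite /xn /= -/(cprod _ _); apply: le_trans (nrm_cprod_nseq _ _ x1) _.
  apply: le_trans (nrmM _ _) _.
  have := ler_pM (nrm_ge0 x) (nrm_ge0 x) x2 x2; lra.
(* On the ball of radius 1/2 the map has values of norm at most (1/4 + 1/4) / 2 and Lipschitz
   constant (1/2 + 1/2) / 2. *)
have [||||v [vs xv _] vE] := @contraction_fixpoint R A
    (fun v => [/\ star v = v, x ** v = v ** x & nrm v <= 1 / 2])
    (fun v => g *: (xn + cprod v (nseq h.*2 x) ** v)) 0.
- by split; rewrite ?star0 ?cmulr0 ?cmul0r ?nrm0 //; lra.
- move=> v [vs xv v2]; split.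
  + rewrite starZr starD starM star_cprod_nseq // star_cprod_nseq // vs xs.
    by rewrite lpow_self -cprod_nseq_mul.
  + rewrite -cscalerAl -cscalerAr cmulDr cmulDl; congr (_ *: (_ + _)).
      exact: cprod_nseq_comm.
    by rewrite cmulA cprod_nseq_comm // -!cmulA xv.
  + rewrite nrm_half; have := nrmD xn (cprod v (nseq h.*2 x) ** v).
    have := nrmM (cprod v (nseq h.*2 x)) v.
    have := nrm_cprod_nseq v h.*2 x1 => vN.
    have := ler_pM (nrm_ge0 _) (nrm_ge0 _) (le_trans vN v2) v2; lra.
- move=> u l C Su ul; split.
  + apply/eqP; rewrite -subr_eq0; apply/eqP.
    apply: (squeeze0 (C := 2 * C)) => k; have [us _ _] := Su k.
    rewrite (_ : star l - l = star (l - u k) - (l - u k)).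
      by apply: le_trans (nrmB _ _) _; rewrite nrm_star; have := ul k; lra.
    by rewrite starB us; zmod.
  + by apply: comm_closed ul => k; have [] := Su k.
  + apply: (le_geometric (C := C)) => k; have [_ _ u2] := Su k.
    rewrite (_ : l = u k + (l - u k)); last by zmod.
    by apply: le_trans (nrmD _ _) _; exact: lerD.
- move=> v w [_ _ v2] [_ _ w2].
  rewrite -scalerBr nrm_half ler_pM2r ?invr_gt0 //.
  have -> : xn + cprod v (nseq h.*2 x) ** v - (xn + cprod w (nseq h.*2 x) ** w)
      = cprod (v - w) (nseq h.*2 x) ** v + cprod w (nseq h.*2 x) ** (v - w).
    by rewrite cprodBl cmulBl cmulBr; zmod.
  apply: le_trans (nrmD _ _) _.
  apply: le_trans (lerD (nrmM _ _) (nrmM _ _)) _.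
  have := ler_pM (nrm_ge0 _) (nrm_ge0 _) (nrm_cprod_nseq (v - w) h.*2 x1) v2.
  have := ler_pM (nrm_ge0 _) (nrm_ge0 (v - w))
    (le_trans (nrm_cprod_nseq w h.*2 x1) w2) (lexx _).
  lra.
by exists v; split=> //; rewrite -{1 2}vE scale_half_double.
Qed.

Context {A B : cstarAlgType R} {h : nat} {phi : {linear A -> B}}.
Hypotheses (phi_nhom : nhom h.*2.+2 phi) (phi_inv : involutive_map phi).

Lemma nhom_unit_ball (x : A) : star x = x -> nrm x <= 1 / 2 -> nrm (phi x) <= 1.
Proof.
move=> xs x2; have [v [vs xv vE]] := quadratic_fixpoint h xs x2.
pose X := phi x; pose V := phi v; pose Q := cprod X (nseq h.*2 X).
have Xs : star X = X by rewrite -phi_inv xs.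
have Vs : star V = V by rewrite -phi_inv vs.
have VE : V + V = cprod X (nseq h.*2.+1 X) + cprod V (nseq h.*2 X) ** V.
  rewrite -linearD vE linearD -cprod_rcons.
  rewrite !phi_nhom ?(size_rcons, size_nseq) //.
  by rewrite map_rcons !map_nseq cprod_rcons.
(* Only words of length 1 or n = 2h + 2 transfer through [phi], so Q = X^(2h+1), rather than X, is
   shown to commute with V. *)
have QV : Q ** V = V ** Q.
  transitivity (phi (cprod x (nseq h.*2 x) ** v)).
    rewrite -cprod_rcons phi_nhom ?size_rcons ?size_nseq //.
    by rewrite map_rcons map_nseq cprod_rcons.
  rewrite -cprod_nseq_comm // cmul_cprod.
  rewrite -[cprod _ _]/(cprod v (nseq h.*2.+1 x)).
  by rewrite phi_nhom ?size_nseq // map_nseq cmul_cprod.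
(* Placing X^h on each side makes p self-adjoint without commuting X and V. *)
pose p := lpow h X (cprod V (nseq h X)).
have Qs : star Q = Q by rewrite star_cprod_nseq // Xs lpow_self.
have ps : star p = p by rewrite star_lpow // star_cprod_nseq // Vs -lpow_cprod.
have QX : Q ** X = X ** Q by rewrite -cprod_nseq_comm.
have Qp : Q ** p = p ** Q.
  by apply: lpow_comm => //; exact: cprod_nseq_comm.
have pp : p ** p = lpow h X
    (cprod (cprod V (nseq h.*2 X) ** V) (nseq h X)).
  rewrite {1}/p -lpowM; congr lpow.
  by rewrite /p -cprod_nseq_mul cprod_nseq_cat addnn cmul_cprod.
have QQ : Q ** Q = lpow h X (cprod (cprod X (nseq h.*2.+1 X)) (nseq h X)).
  rewrite !lpow_cprod lpow_self !cprod_nseq_cat cprod_nseq_mulself.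
  by congr (cprod _ (nseq _ _)); rewrite -addnn; lia.
have Q1 : nrm Q <= 1.
  apply: (nrm_commuting_circle ps Qs Qp).
  (* Q^2 + p^2 = X^h (X^(2h+2) + V X^(2h) V) X^h = X^h (V + V) X^h = p + p. *)
  by rewrite pp QQ -lpowD -cprodDl -VE cprodDl lpowD.
have := nrm_pow_ge h.*2 Xs; rewrite -/Q => XQ.
rewrite leNgt; apply/negP => X1; have := le_trans XQ Q1.
by rewrite leNgt exprn_egt1.
Qed.

(** The factor 2 comes from rescaling x to norm 1/2. *)
Lemma nhom_bound_selfadjoint (x : A) : star x = x -> nrm (phi x) <= 2 * nrm x.
Proof.
move=> xs; have [->|x0] := eqVneq x 0; first by rewrite raddf0 !nrm0 mulr0.
have r0 := nrm_gt0 x0.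
have s0 : 0 < 2 * nrm x by rewrite mulr_gt0.
pose s : R[i] := (2 * nrm x)^-1%:C%C.
have sN (C : cstarAlgType R) (a : C) : nrm (s *: a) = nrm a / (2 * nrm x).
  by rewrite nrmZV.
have : nrm (phi (s *: x)) <= 1.
  apply: nhom_unit_ball; first by rewrite starZr xs.
  by rewrite sN ler_pdivrMr //; lra.
by rewrite linearZ /= sN ler_pdivrMr // mul1r.
Qed.

Lemma nhom_bounded : bounded_map phi.
Proof.
(* 2 a = u - i w with u and w self-adjoint of norm at most 2 |a|, so |2 phi(a)| <= 4 |a| + 4 |a|. *)
exists 4 => a; rewrite !nrmE -rmorphM /= lecR.
pose u := a + star a; pose w := 'i%C *: (a - star a).
have us : star u = u by rewrite /u starD starK addrC.
have ws : star w = w by rewrite /w starZi starB starK -scalerN opprB.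
have phiw : nrm (phi w) = nrm (phi (a - star a)) by rewrite /w linearZ /= nrmZi.
have wN : nrm w <= 2 * nrm a.
  by rewrite /w nrmZi; have := nrmB a (star a); rewrite nrm_star; lra.
have uN : nrm u <= 2 * nrm a.
  by have := nrmD a (star a); rewrite nrm_star -/u; lra.
have := nrm_double (phi a).
have -> : phi a + phi a = phi u + phi (a - star a).
  by rewrite -!raddfD /u; congr (phi _); zmod.
have := nrmD (phi u) (phi (a - star a)); rewrite -phiw.
have := nhom_bound_selfadjoint us; have := nhom_bound_selfadjoint ws; lra.
Qed.

End Bounded.

Theorem theorem2p3 (R : realType) (A B : cstarAlgType R) (n : nat)
    (hn2 : (2 <= n)%N) (hn_even : ~~ odd n)
    (phi : {linear A -> B})
    (phi_nhom : nhom n phi) (phi_inv : involutive_map phi) :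
  completely_positive phi /\ bounded_map phi.
Proof.
split; first exact: nhom_completely_positive phi_nhom phi_inv hn2 hn_even.
have := odd_double_half n; rewrite (negPf hn_even) add0n => nE.
have : (0 < n./2)%N by rewrite half_gt0.
case: (n./2) nE => // h nE _; rewrite -nE doubleS in phi_nhom.
exact: nhom_bounded phi_nhom phi_inv.
Qed.
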